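(* Let $\Omega\subset\mathbb{R}^n$ be a domain and let $u:\Omega\to\mathbb{R}$ be a smooth and convex solution of $$\det(\nabla^2u)=f(u,\nabla u),$$ where $f>0$. Assume that for constants $0<\lambda\le\Lambda$, $$\lambda|\xi|^2\le\sum_{i,j}\mathrm{adj}^T(\nabla^2u)_{ij}\,\xi_i\xi_j\le\Lambda|\xi|^2\qquad\text{for all }x\in\Omega,\ \xi\in\mathbb{R}^n,$$ and assume $|\nabla^2u|^2\in L^n(\Omega)$ and $|f_s|,|f_{q_i}|,|\mathrm{adj}^T(\nabla^2u)_{ij}|\le M$. Then for any $B_{2R}\subset\Omega$, $$\sup_{B_R}|\nabla u|^2\le C\left(\inf_{B_R}|\nabla u|^2+\frac{R}{\lambda}\|\nabla^2u\|^2_{L^{2n}(B_{2R})}\right),$$ where $C=C(n,\lambda,\Lambda,MR^2)$.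
   Context: $f=f(s,q)$ is a function of $s\in\mathbb{R}$ and $q\in\mathbb{R}^n$, with $f_s=\partial f/\partial s$, $f_{q_i}=\partial f/\partial q_i$. $\mathrm{adj}^T(A)$ is the transpose of the adjugate (i.e. the cofactor matrix) of $A$, so that $\partial\det(A)/\partial a_{ij}=\mathrm{adj}^T(A)_{ij}$. $B_R$ and $B_{2R}$ are concentric balls of radii $R$ and $2R$. *)

(* Defs.v *)
From HB Require Import structures.
From mathcomp Require Import all_boot all_order all_algebra.
From mathcomp Require Import all_classical all_reals all_analysis.

Set Implicit Arguments.
Unset Strict Implicit.
Unset Printing Implicit Defensive.

Import Order.TTheory GRing.Theory Num.Theory.
Import numFieldNormedType.Exports.

Local Open Scope classical_set_scope.
Local Open Scope ring_scope.

(* The library norm on matrices is the sup norm (same topology).  [enorm] is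
   the Euclidean norm on row vectors and the Frobenius norm on matrices. *)
Definition enorm (R : realType) m n (A : 'M[R]_(m, n)) : R :=
  Num.sqrt (\sum_i \sum_j A i j ^+ 2).

Definition eball (R : realType) n (x : 'rV[R]_n) (r : R) : set 'rV[R]_n :=
  [set y | enorm (y - x) < r].

Definition domain (R : realType) n (O : set 'rV[R]_n) : Prop :=
  [/\ open O, connected O & O !=set0].

Definition partial (R : realType) n (i : 'I_n) (g : 'rV[R]_n -> R)
  : 'rV[R]_n -> R := 'D_(delta_mx 0 i) g.

Definition partials (R : realType) n (s : seq 'I_n) (g : 'rV[R]_n -> R)
  : 'rV[R]_n -> R := foldr (@partial R n) g s.

(* [derive] has a junk value where the limit does not exist, so existence of
   the derivatives is required separately. *)
Definition smooth_on (R : realType) n (O : set 'rV[R]_n)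
    (g : 'rV[R]_n -> R) : Prop :=
  forall (s : seq 'I_n) (x : 'rV[R]_n), O x ->
    {for x, continuous (partials s g)} /\
    forall i : 'I_n, derivable (partials s g) x (delta_mx 0 i).

(* [O] need not be convex: convexity is required along every segment
   contained in [O]. *)
Definition convex_on (R : realType) n (O : set 'rV[R]_n)
    (g : 'rV[R]_n -> R) : Prop :=
  forall x y : 'rV[R]_n,
    (forall t : R, 0 <= t <= 1 -> O (t *: x + (1 - t) *: y)) ->
    forall t : R, 0 <= t <= 1 ->
      g (t *: x + (1 - t) *: y) <= t * g x + (1 - t) * g y.

Definition grad (R : realType) n (g : 'rV[R]_n -> R) (x : 'rV[R]_n)
  : 'rV[R]_n := \row_i partial i g x.

Definition hess (R : realType) n (g : 'rV[R]_n -> R) (x : 'rV[R]_n)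
  : 'M[R]_n := \matrix_(i, j) partial i (partial j g) x.

Definition adjT (R : realType) n (A : 'M[R]_n) : 'M[R]_n := (\adj A)^T.

(* The product (equivalently, Borel) sigma-algebra on R^n, generated by the
   coordinate maps. *)
Section measurable_rV.
Variables (R : realType) (n : nat).

Let coord (i : 'I_n) (x : 'rV[R]_n) : measurableTypeR R := x 0 i.

Let rV_set0 : g_sigma_preimage coord set0.
Proof. exact: sigma_algebra0. Qed.

Let rV_setC A : g_sigma_preimage coord A -> g_sigma_preimage coord (~` A).
Proof. exact: sigma_algebraC. Qed.

Let rV_bigcup (F : (set 'rV[R]_n)^nat) :
  (forall i, g_sigma_preimage coord (F i)) ->
  g_sigma_preimage coord (\bigcup_i (F i)).
Proof. exact: sigma_algebra_bigcup. Qed.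

HB.instance Definition _ := @isMeasurable.Build default_measure_display
  'rV[R]_n (g_sigma_preimage coord) rV_set0 rV_setC rV_bigcup.

Lemma measurable_coord (i : 'I_n) :
  measurable_fun [set: 'rV[R]_n] (fun x => x 0 i : measurableTypeR R).
Proof.
move=> _ Y mY; rewrite setTI; apply: sub_sigma_algebra => /=.
rewrite -bigcup_seq/=; exists i => /=; first by rewrite mem_index_enum.
by exists Y => //; rewrite setTI.
Qed.

Lemma measurable_fun_rV d (T : measurableType d) (f : T -> 'rV[R]_n) :
  (forall i, measurable_fun [set: T] (fun x => f x 0 i : measurableTypeR R)) ->
  measurable_fun [set: T] f.
Proof.
move=> mf.
suff H : g_sigma_preimage (fun i => coord i \o f) `<=` measurable.
  move=> _ A mA; apply: H; rewrite g_sigma_preimage_comp.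
  by exists A.
apply: smallest_sub; first exact: sigma_algebra_measurable.
by rewrite -bigcup_seq => A [i _ [B mB <-]]; exact: mf.
Qed.

End measurable_rV.

(* Lebesgue measure on R^n, by iterated products of the one-dimensional one;
   on R^0 it is the unit mass. *)
Definition rV_cons (R : realType) n (p : 'rV[R]_n * measurableTypeR R)
  : 'rV[R]_n.+1 := row_mx (const_mx p.2 : 'rV[R]_1) p.1.

Fixpoint lebesgue_rV (R : realType) n : set 'rV[R]_n -> \bar R :=
  match n return set 'rV[R]_n -> \bar R with
  | 0 => \d_ (0 : 'rV[R]_0)
  | m.+1 => pushforward (@lebesgue_rV R m \x @lebesgue_measure R)%E
              (@rV_cons R m)
  end.

Section lebesgue_rV_measure.
Variable R : realType.

Lemma rV_consE0 n p : @rV_cons R n p 0 0 = p.2.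
Proof.
transitivity ((const_mx p.2 : 'rV[R]_1) 0 0); last by rewrite mxE.
rewrite -(row_mxEl (const_mx p.2 : 'rV_1) p.1).
by congr (rV_cons p _ _); exact/val_inj.
Qed.

Lemma rV_consES n p i : @rV_cons R n p 0 (lift ord0 i) = p.1 0 i.
Proof.
rewrite -(row_mxEr (const_mx p.2 : 'rV_1) p.1).
by congr (rV_cons p _ _); exact/val_inj.
Qed.

Lemma measurable_rV_cons n : measurable_fun setT (@rV_cons R n).
Proof.
apply: measurable_fun_rV => i; case: (unliftP ord0 i) => [j|] ->.
  under eq_fun do rewrite rV_consES.
  exact: measurableT_comp (measurable_coord j) measurable_fst.
under eq_fun do rewrite rV_consE0.
exact: measurable_snd.
Qed.

Let lebesgue_rV_ex n :
  exists m : {measure set 'rV[R]_n -> \bar R}, @lebesgue_rV R n = m.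
Proof.
elim: n => [|n [m mE]] /=; first by eexists.
rewrite mE.
by exists (measure_function_pushforward__canonical__measure_function_Measure
  (m \x @lebesgue_measure R)%E (@measurable_rV_cons n)).
Qed.

Variable n : nat.

Let lebesgue_rV0 : @lebesgue_rV R n set0 = 0%E.
Proof. by have [m ->] := lebesgue_rV_ex n. Qed.

Let lebesgue_rV_ge0 A : (0 <= @lebesgue_rV R n A)%E.
Proof. by have [m ->] := lebesgue_rV_ex n. Qed.

Let lebesgue_rV_sigma_additive : semi_sigma_additive (@lebesgue_rV R n).
Proof.
by have [m ->] := lebesgue_rV_ex n; exact: measure_semi_sigma_additive.
Qed.

HB.instance Definition _ := isMeasure.Build _ 'rV[R]_n R (@lebesgue_rV R n)
  lebesgue_rV0 lebesgue_rV_ge0 lebesgue_rV_sigma_additive.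

End lebesgue_rV_measure.

Lemma measurable_box (R : realType) n (A : 'I_n -> set (measurableTypeR R)) :
  (forall i, measurable (A i)) ->
  measurable [set x : 'rV[R]_n | forall i, A i (x 0 i)].
Proof.
move=> mA.
have -> : [set x : 'rV[R]_n | forall i, A i (x 0 i)] =
    \bigcap_(i in [set: 'I_n]) ((fun x : 'rV[R]_n => x 0 i) @^-1` A i).
  by apply/seteqP; split=> x /= h i; [move=> _; exact: h|exact: h].
apply: fin_bigcap_measurable => // i _; rewrite -[X in measurable X]setTI.
exact: measurable_coord.
Qed.

Lemma lebesgue_rV_box (R : realType) n (A : 'I_n -> set (measurableTypeR R)) :
  (forall i, measurable (A i)) ->
  lebesgue_rV [set x : 'rV[R]_n | forall i, A i (x 0 i)] =
  (\prod_(i < n) lebesgue_measure (A i))%E.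
Proof.
elim: n A => [|n IH] A mA.
  by rewrite big_ord0 /= diracE mem_set//; case.
rewrite big_ord_recl/= /pushforward.
pose B := [set x : 'rV[R]_n | forall i, A (lift ord0 i) (x 0 i)].
rewrite (_ : _ @^-1` _ = B `*` A ord0); last first.
  apply/seteqP; split=> [[x y]/= h|[x y] [/= hx hy] i].
    split=> [i|]; first by have := h (lift ord0 i); rewrite rV_consES.
    by have := h ord0; rewrite rV_consE0.
  by case: (unliftP ord0 i) => [j|] ->; rewrite ?rV_consES ?rV_consE0.
have mB : measurable B by apply: (@measurable_box _ _ (fun i => A (lift ord0 i))).
by rewrite product_measure1E// muleC -IH.
Qed.

(* Main.v *)
Require Import Defs.
From mathcomp Require Import all_boot all_order all_algebra all_fingroup.
From mathcomp Require Import all_classical all_reals all_analysis.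
From mathcomp Require Import measurable_realfun ring lra.

(** The two-sided bound on the cofactor matrix of the Hessian makes the
    equation uniformly elliptic, and for [n >= 2] this already controls the
    Hessian itself from both sides, so the inequality follows from first-order
    calculus.

    Let [A] be the Hessian at a point and [B] its cofactor matrix, so that
    [A *m B^T = (\det A)%:M].
    - The entries of [B] are minors of [A] of order [n - 1], and
      [lam <= B i i]; hence the Frobenius norm of [A] is at least a constant
      [k] depending on [n] and [lam] ([elliptic_enorm_ge]).
    - [A] is symmetric by Schwarz's theorem ([partialC], from the mean value
      theorem applied twice), so [B] is symmetric and positive and its entries
      are at most [Lam].  Then [(\det A) ^+ (n - 1) = \det B] bounds [\det A],
      and coercivity of [B] turns this into a bound [K] on the entries of [A]
      ([elliptic_norm_entry_le]).

    The upper bound makes the gradient Lipschitz.  Moving one coordinate at a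
    time from [y] to [x] stays in the ball of radius [2 * r], and gives
    [|grad u x|^2 <= 2 |grad u y|^2 + 8 n^3 K^2 r^2]
    ([sum_sqr_partial_diff_le]).  The lower bound, integrated over a cube of
    half-side [r / n] inside the ball of radius [2 * r], shows that the squared
    [L^(2n)] norm of the Hessian is at least [2 k^2 r / n]
    ([Lnorm_cube_ge]); multiplied by [r / lam] it is of the same order [r^2] as
    the oscillation term, which it therefore absorbs.

    For [n = 1] the cofactor matrix is the constant [1] and says nothing about
    [u'']; there the fundamental theorem of calculus and the Cauchy-Schwarz
    inequality give [(u' x - u' y)^2 <= 2 r \int (u'')^2], and the integral is
    the squared [L^2] norm of the Hessian
    ([sqr_partial_diff_le_Lnorm]).

    The supremum and the infimum are compared through the pointwise inequality
    between two arbitrary points ([ereal_sup_le_ereal_inf]). *)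

Set Implicit Arguments.
Unset Strict Implicit.

Import Order.TTheory GRing.Theory Num.Theory.
Import numFieldNormedType.Exports.

Local Open Scope classical_set_scope.
Local Open Scope ring_scope.

(** * Matrices with an elliptic cofactor matrix *)

Section matrix_bounds.
Variable R : realType.

Lemma enorm_sqr m n (A : 'M[R]_(m, n)) :
  enorm A ^+ 2 = \sum_i \sum_j A i j ^+ 2.
Proof.
by rewrite sqr_sqrtr// sumr_ge0// => i _; rewrite sumr_ge0// => j _; exact: sqr_ge0.
Qed.

Lemma enorm_ge0 m n (A : 'M[R]_(m, n)) : 0 <= enorm A.
Proof. exact: sqrtr_ge0. Qed.

Lemma enorm_row_sqr n (x : 'rV[R]_n) : enorm x ^+ 2 = \sum_j x 0 j ^+ 2.
Proof. by rewrite enorm_sqr big_ord1. Qed.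

Lemma sqr_entry_le_enorm m n (A : 'M[R]_(m, n)) i j : A i j ^+ 2 <= enorm A ^+ 2.
Proof.
rewrite enorm_sqr (bigD1 i)//= (bigD1 j)//= -addrA lerDl addr_ge0 ?sumr_ge0//.
  by move=> k _; exact: sqr_ge0.
by move=> k _; rewrite sumr_ge0// => l _; exact: sqr_ge0.
Qed.

Lemma norm_entry_le_enorm m n (A : 'M[R]_(m, n)) i j : `|A i j| <= enorm A.
Proof.
by rewrite -ler_sqr ?nnegrE ?enorm_ge0// real_normK ?num_real// sqr_entry_le_enorm.
Qed.

Lemma norm_det_le n (A : 'M[R]_n) a :
  (forall i j, `|A i j| <= a) -> `|\det A| <= n`!%:R * a ^+ n.
Proof.
move=> Aa; rewrite /determinant (le_trans (ler_norm_sum _ _ _))//.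
apply: (@le_trans _ _ (\sum_(s : 'S_n) a ^+ n)).
  apply: ler_sum => s _; rewrite normrM normrX normrN1 expr1n mul1r normr_prod.
  rewrite -[X in a ^+ X](card_ord n) -prodr_const.
  by apply: ler_prod => i _; rewrite normr_ge0 Aa.
by rewrite sumr_const card_Sn mulr_natl.
Qed.

Lemma norm_adjT_le n (A : 'M[R]_n.+1) i j :
  `|adjT A i j| <= n`!%:R * enorm A ^+ n.
Proof.
rewrite !mxE /cofactor normrM normrX normrN1 expr1n mul1r.
by apply: norm_det_le => k l; rewrite !mxE norm_entry_le_enorm.
Qed.

(** Take determinants in [A *m \adj A = (\det A)%:M] and cancel one factor
    [\det A]. *)
Lemma det_adjT n (A : 'M[R]_n.+1) : \det A != 0 -> \det (adjT A) = \det A ^+ n.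
Proof.
move=> d0; apply: (mulfI d0).
by rewrite /adjT det_tr -det_mulmx mul_mx_adj det_scalar exprS.
Qed.

Definition quad n (B : 'M[R]_n) (xi : 'rV[R]_n) : R :=
  \sum_i \sum_j B i j * xi 0 i * xi 0 j.

Lemma quadE n (B : 'M[R]_n) xi : quad B xi = (xi *m B *m xi^T) 0 0.
Proof.
rewrite mxE /quad exchange_big/=. apply: eq_bigr => j _.
by rewrite !mxE mulr_suml; apply: eq_bigr => i _; rewrite [B i j * _]mulrC.
Qed.

Lemma delta_formE n (B : 'M[R]_n) i j :
  ((delta_mx 0 i : 'rV_n) *m B *m (delta_mx 0 j : 'rV_n)^T) 0 0 = B i j.
Proof. by rewrite -rowE trmx_delta -colE !mxE. Qed.

Lemma quad_delta n (B : 'M[R]_n) i : quad B (delta_mx 0 i) = B i i.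
Proof. by rewrite quadE delta_formE. Qed.

Lemma enorm_delta n (i : 'I_n) : enorm (delta_mx 0 i : 'rV[R]_n) ^+ 2 = 1.
Proof.
rewrite enorm_row_sqr (bigD1 i)//= big1 => [|j ji]; rewrite !mxE !eqxx /=.
  by rewrite addr0 expr1n.
by rewrite (negbTE ji) expr0n.
Qed.

Variables (n : nat) (A : 'M[R]_n.+2) (lam Lam : R).
Hypothesis lam_gt0 : 0 < lam.
Hypothesis quad_bounds : forall xi : 'rV[R]_n.+2,
  lam * enorm xi ^+ 2 <= quad (adjT A) xi <= Lam * enorm xi ^+ 2.

(** Since [lam <= adjT A 0 0 <= (n+1)! (enorm A) ^+ (n+1)], either [enorm A] is
    at least [1], or its power is below [enorm A] and the root need not be
    taken. *)
Lemma elliptic_enorm_ge : Num.min 1 (lam / n.+1`!%:R) <= enorm A.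
Proof.
have f0 : 0 < n.+1`!%:R :> R by rewrite ltr0n fact_gt0.
have /andP[+ _] := quad_bounds (delta_mx 0 0).
rewrite enorm_delta mulr1 quad_delta => lB.
have {}lB : lam <= n.+1`!%:R * enorm A ^+ n.+1.
  by rewrite (le_trans lB)// (le_trans (ler_norm _))// norm_adjT_le.
have [A1|/ltW A1] := leP 1 (enorm A); first by rewrite ge_min A1.
rewrite ge_min ler_pdivrMr// mulrC (le_trans lB) ?orbT//.
by rewrite ler_pM2l// exprS ler_piMr ?enorm_ge0// exprn_ile1 ?enorm_ge0.
Qed.

Hypothesis symA : A^T = A.
Hypothesis det_gt0 : 0 < \det A.

(** Polarization: positivity of the form at [e_i + e_j] and at [e_i - e_j] bounds
    an off-diagonal entry by the mean of two diagonal entries.  The symmetry of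
    [A] enters here, since the quadratic form does not see the antisymmetric
    part of the cofactor matrix. *)
Lemma elliptic_norm_adjT_le i j : `|adjT A i j| <= Lam.
Proof.
have symB : adjT A j i = adjT A i j.
  by rewrite /adjT [RHS]mxE trmx_adj symA.
have diag k : adjT A k k <= Lam.
  by have /andP[_] := quad_bounds (delta_mx 0 k); rewrite enorm_delta mulr1 quad_delta.
have psd xi : 0 <= quad (adjT A) xi.
  by have /andP[+ _] := quad_bounds xi; apply: le_trans; rewrite mulr_ge0 ?sqr_ge0 ?ltW.
have addE (P Q : 'M[R]_1) : (P + Q) 0 0 = P 0 0 + Q 0 0 by rewrite mxE.
have oppE (P : 'M[R]_1) : (- P) 0 0 = - P 0 0 by rewrite mxE.
have := psd (delta_mx 0 i - delta_mx 0 j).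
have := psd (delta_mx 0 i + delta_mx 0 j).
rewrite !quadE !linearD !linearN /= !(mulmxDl, mulmxDr, mulNmx, mulmxN).
rewrite !(addE, oppE) !delta_formE symB ler_norml => p m.
have di := diag i; have dj := diag j.
by apply/andP; split; lra.
Qed.

(** If [\det A] exceeds [1], it is at most its own power [\det A ^+ (n+1)], which
    is the determinant of the cofactor matrix. *)
Lemma elliptic_det_le : \det A <= 1 + n.+2`!%:R * Lam ^+ n.+2.
Proof.
have Lam0 : 0 <= Lam by rewrite (le_trans _ (elliptic_norm_adjT_le 0 0)).
have c0 : 0 <= n.+2`!%:R * Lam ^+ n.+2 by rewrite mulr_ge0 ?exprn_ge0.
have [d1|/ltW d1] := leP (\det A) 1; first by rewrite (le_trans d1) ?lerDl.
apply: (@le_trans _ _ (\det A ^+ n.+1)); first by rewrite exprS ler_peMr ?exprn_ege1 ?(ltW det_gt0).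
rewrite -det_adjT ?gt_eqF// (le_trans (ler_norm _))//.
by rewrite (le_trans (norm_det_le elliptic_norm_adjT_le))// lerDr.
Qed.

(** For the row [a] of index [i] of [A], the cofactor identity gives
    [quad (adjT A) a = \det A * a_i].  Coercivity therefore yields
    [lam |a|^2 <= \det A * a_i <= \det A * |a|], that is [lam |a| <= \det A]. *)
Lemma elliptic_norm_entry_le i j :
  `|A i j| <= (1 + n.+2`!%:R * Lam ^+ n.+2) / lam.
Proof.
set d := \det A; set a := row i A.
have aB : quad (adjT A) a = d * a 0 i.
  have -> : quad (adjT A) a = (a *m (adjT A)^T *m a^T) 0 0.
    have tE (P : 'M[R]_1) : P 0 0 = P^T 0 0 by rewrite mxE.
  by rewrite quadE tE !trmx_mul trmxK mulmxA.
  rewrite /adjT trmxK /a -row_mul mul_mx_adj [row i _%:M]rowE mul_mx_scalar.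
  by rewrite -scalemxAl -rowE !mxE.
have [+ _] := andP (quad_bounds a); rewrite aB => lea.
have a_le k : a 0 k ^+ 2 <= enorm a ^+ 2 by exact: sqr_entry_le_enorm.
have d0 : 0 < d by [].
have ai_ge0 : 0 <= a 0 i.
  rewrite -(pmulr_rge0 _ d0) (le_trans _ lea)// mulr_ge0 ?sqr_ge0// ltW//.
have ai : lam * a 0 i <= d.
  have [->|ai0] := eqVneq (a 0 i) 0; first by rewrite mulr0 ltW.
  have ap : 0 < a 0 i by rewrite lt_def ai0.
  rewrite -(ler_pM2r ap) -mulrA -expr2 (le_trans _ lea)// ler_pM2l//.
have aj : (lam * a 0 j) ^+ 2 <= d ^+ 2.
  rewrite !exprMn expr2 -mulrA (le_trans (ler_wpM2l (ltW lam_gt0) (ler_wpM2l (ltW lam_gt0) (a_le j))))//.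
  rewrite (le_trans (ler_wpM2l (ltW lam_gt0) lea))// mulrCA expr2 ler_pM2l//.
have {aj} : `|lam * a 0 j| <= d.
  by rewrite -ler_sqr ?nnegrE ?(ltW d0)// real_normK ?num_real.
rewrite normrM gtr0_norm// mxE ler_pdivlMr// mulrC => /le_trans; apply.
exact: elliptic_det_le.
Qed.
End matrix_bounds.

(** * Calculus along coordinate directions *)

Section coordinate_calculus.
Variables (R : realType) (n : nat).
Implicit Types (g : 'rV[R]_n -> R) (x : 'rV[R]_n) (i j : 'I_n).
Local Notation e_ i := (delta_mx 0 i : 'rV[R]_n).

Lemma is_derive_line g x i (t : R) :
  derivable g (x + t *: e_ i) (e_ i) ->
  is_derive t (1 : R) (fun s : R => g (x + s *: e_ i))
    (partial i g (x + t *: e_ i)).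
Proof.
move=> dg.
have E : (fun h : R => h^-1 *: (((fun s : R => g (x + s *: e_ i)) \o shift t)
      (h *: (1 : R)) - g (x + t *: e_ i))) =
    (fun h : R => h^-1 *: ((g \o shift (x + t *: e_ i)) (h *: e_ i)
      - g (x + t *: e_ i))).
  apply/funext => h /=; congr (_ *: (g _ - _)).
  by rewrite [h *: 1]mulr1 scalerDl addrCA.
split; first by rewrite /derivable E.
by rewrite /partial /derive E.
Qed.

Lemma MVT_line g x i (h : R) : 0 <= h ->
  (forall t, 0 <= t <= h -> derivable g (x + t *: e_ i) (e_ i)) ->
  exists2 t, 0 <= t <= h &
    g (x + h *: e_ i) - g x = h * partial i g (x + t *: e_ i).
Proof.
move=> h0 dg; pose F (s : R) := g (x + s *: e_ i).
have dF t : 0 <= t <= h -> is_derive t (1 : R) F (partial i g (x + t *: e_ i)).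
  by move=> th; apply: is_derive_line; exact: dg.
have [t| |t tI] := @MVT_segment R F
    (fun t => partial i g (x + t *: e_ i)) 0 h h0.
- by rewrite in_itv/= => /andP[t0 th]; apply: dF; rewrite !ltW.
- apply: derivable_within_continuous => t.
  by rewrite in_itv/= => /dF[].
- rewrite subr0 /F scale0r addr0 => E; exists t; last by rewrite E mulrC.
  by move: tI; rewrite in_itv.
Qed.

Lemma norm_line_diff_le_ge0 g x i (K h : R) : 0 <= h ->
  (forall t, 0 <= t <= h -> derivable g (x + t *: e_ i) (e_ i)) ->
  (forall t, 0 <= t <= h -> `|partial i g (x + t *: e_ i)| <= K) ->
  `|g (x + h *: e_ i) - g x| <= K * h.
Proof.
move=> h0 dg Kg; have [t th ->] := MVT_line h0 dg.
by rewrite normrM (ger0_norm h0) mulrC ler_wpM2r// Kg.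
Qed.

(** The mean value theorem along [e_i] is applied to the increment of [g] along
    [e_j], then along [e_j] to [partial i g]. *)
Lemma second_difference g x i j (h : R) : 0 <= h ->
  (forall s t, 0 <= s <= h -> 0 <= t <= h ->
     derivable g (x + s *: e_ i + t *: e_ j) (e_ i)
  /\ derivable (partial i g) (x + s *: e_ i + t *: e_ j) (e_ j)) ->
  exists s t, [/\ 0 <= s <= h, 0 <= t <= h &
    (g (x + h *: e_ i + h *: e_ j) - g (x + h *: e_ i))
    - (g (x + h *: e_ j) - g x)
    = h * (h * partial j (partial i g) (x + s *: e_ i + t *: e_ j))].
Proof.
move=> h0 dg.
have hh : 0 <= h <= h by rewrite h0 lexx.
have zh : 0 <= (0 : R) <= h by rewrite h0 lexx.
pose F (s : R) := g (x + h *: e_ j + s *: e_ i) - g (x + s *: e_ i).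
pose dF (s : R) := partial i g (x + h *: e_ j + s *: e_ i) - partial i g (x + s *: e_ i).
have dFP s : 0 <= s <= h -> is_derive s (1 : R) F (dF s).
  move=> sh; apply: is_deriveB; apply: is_derive_line.
    by rewrite addrAC; exact: (dg s h sh hh).1.
  by have := (dg s 0 sh zh).1; rewrite scale0r addr0.
have [s| |s sI E] := @MVT_segment R F dF 0 h h0.
- by rewrite in_itv/= => /andP[s0 sh]; apply: dFP; rewrite !ltW.
- apply: derivable_within_continuous => s.
  by rewrite in_itv/= => /dFP[].
have {}sI : 0 <= s <= h by move: sI; rewrite in_itv.
have [t th Et] := MVT_line h0 (fun t th => (dg s t sI th).2).
exists s, t; split => //; rewrite -Et.
move: E; rewrite subr0 /F /dF scale0r !addr0 (addrAC x (h *: e_ j)) => ->.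
by rewrite mulrC (addrAC x (h *: e_ j)).
Qed.

(** Schwarz's theorem: the second difference of [g] over a small square is
    symmetric in the two directions, and it is [h ^+ 2] times either mixed
    derivative at some point of the square; let the square shrink to [x]. *)
Lemma partialC (O : set 'rV[R]_n) g x i j : open O -> O x ->
  (forall y k, O y -> derivable g y (e_ k)) ->
  (forall y k l, O y -> derivable (partial k g) y (e_ l)) ->
  (forall k l, {for x, continuous (partial k (partial l g))}) ->
  partial i (partial j g) x = partial j (partial i g) x.
Proof.
move=> oO Ox d1 d2 c2.
apply/eqP; rewrite -subr_eq0 -normr_eq0; apply/eqP/le_anti.
rewrite normr_ge0 andbT; apply/ler_addgt0Pr => e e0; rewrite add0r.
have e2 : 0 < e / 2 by rewrite divr_gt0.
have tri (a b b' c' : R) :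
    `|a - b| < e / 2 -> `|c' - b'| < e / 2 -> b' = b -> `|a - c'| <= e.
  move=> ab cb bb; apply: (le_trans (ler_distD b _ _)).
  by rewrite [leRHS]splitr lerD ?(ltW ab)// distrC -bb ltW.
have nr k l : \forall y \near x,
    `|partial k (partial l g) x - partial k (partial l g) y| < e / 2.
  by have /cvgrPdist_lt/(_ _ e2) := c2 k l.
have nO : nbhs x O by exact: open_nbhs_nbhs.
have [d /= d0 dP] := (nbhs_ballP x _).1 (filterI nO (filterI (nr i j) (nr j i))).
(* A square of side [h] in any two of the two directions lies in the ball of
   radius [d] for the ambient norm; adding [1] keeps the denominator positive. *)
pose c : R := `|e_ i| + `|e_ j| + 1; have c0 : 0 < c by rewrite ltr_wpDl.
pose h := d / 2 / c; have h0 : 0 < h by rewrite !divr_gt0.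
have inball s t k l : (k == i) && (l == j) || (k == j) && (l == i) ->
    0 <= s <= h -> 0 <= t <= h -> ball x d (x + s *: e_ k + t *: e_ l).
  move=> kl /andP[s0 sh] /andP[t0 th]; rewrite -ball_normE /ball_/=.
  rewrite -addrA opprD addNKr normrN (le_lt_trans (ler_normD _ _))// !normrZ.
  rewrite (ger0_norm s0) (ger0_norm t0).
  apply: (@le_lt_trans _ _ (h * (`|e_ k| + `|e_ l|))).
    by rewrite mulrDr lerD// ler_wpM2r.
  have -> : `|e_ k| + `|e_ l| = `|e_ i| + `|e_ j|.
    by case/orP: kl => /andP[/eqP-> /eqP->]; rewrite // addrC.
  apply: (@lt_trans _ _ (h * c)); first by rewrite ltr_pM2l// ltrDl.
  by rewrite /h divfK ?gt_eqF// ltr_pdivrMr// ltr_pMr// ltr1n.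
have diff k l : (k == i) && (l == j) || (k == j) && (l == i) ->
    exists y, `|partial l (partial k g) x - partial l (partial k g) y| < e / 2 /\
      (g (x + h *: e_ k + h *: e_ l) - g (x + h *: e_ k)) - (g (x + h *: e_ l) - g x)
      = h * (h * partial l (partial k g) y).
  move=> kl; have [|s [t [sh th E]]] := @second_difference g x k l h (ltW h0).
    move=> s t sh th; have [Oy _] := dP _ (inball s t k l kl sh th).
    by split; [exact: d1|exact: d2].
  exists (x + s *: e_ k + t *: e_ l); split => //.
  have [_ [a b]] := dP _ (inball s t k l kl sh th).
  by case/orP: kl a b => /andP[/eqP-> /eqP->] a b; [exact: b|exact: a].
have [|y [yi Ey]] := diff i j; first by rewrite !eqxx.
have [|z [zi Ez]] := diff j i; first by rewrite !eqxx orbT.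
have yz : partial j (partial i g) y = partial i (partial j g) z.
  apply: (mulfI (lt0r_neq0 h0)); apply: (mulfI (lt0r_neq0 h0)).
  apply: etrans (esym Ey) _; apply: etrans _ Ez.
  rewrite (addrAC x (h *: e_ j)).
  have swap (a b c' d' : R) : (a - b) - (c' - d') = (a - c') - (b - d') by ring.
  exact: swap.
exact: (tri _ _ _ _ zi yi yz).
Qed.

End coordinate_calculus.

Section coordinate_paths.
Variables (R : realType) (n : nat).
Local Notation e_ i := (delta_mx 0 i : 'rV[R]_n).

(** The coordinate box spanned by [x] and [y], rather than the segment: paths
    that change one coordinate at a time remain in it. *)
Definition between (x y w : 'rV[R]_n) : Prop :=
  forall i, Num.min (x 0 i) (y 0 i) <= w 0 i <= Num.max (x 0 i) (y 0 i).

(** A convex function on an interval is at most the larger of its values at the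
    end points. *)
Lemma sqr_between_le (s t p c : R) :
  Num.min s t <= p <= Num.max s t ->
  (p - c) ^+ 2 <= (s - c) ^+ 2 + (t - c) ^+ 2.
Proof.
wlog st : s t / s <= t => [H|].
  case/orP: (le_total s t) => [/H//|/H {}H].
  by rewrite minC maxC => /H; rewrite [leRHS]addrC.
rewrite (min_l st) (max_r st) => /andP[sp pt].
have [cp|/ltW pc] := leP c p.
  have h : 0 <= (t - p) * ((t - c) + (p - c)) by rewrite mulr_ge0//; lra.
  have := sqr_ge0 (s - c); lra.
have h : 0 <= (p - s) * ((c - p) + (c - s)) by rewrite mulr_ge0//; lra.
have := sqr_ge0 (t - c); lra.
Qed.

(** Squared coordinates add up, so the box stays in the ball of radius
    [sqrt 2 * r]. *)
Lemma between_eball (c x y w : 'rV[R]_n) r : 0 < r ->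
  eball c r x -> eball c r y -> between x y w -> eball c (2 * r) w.
Proof.
rewrite /eball/= => r0 xr yr b.
have sq z : enorm (z - c) < r -> enorm (z - c) ^+ 2 < r ^+ 2.
  by move=> zr; rewrite ltr_sqr ?nnegrE ?enorm_ge0// ltW.
rewrite -ltr_sqr ?nnegrE ?enorm_ge0 ?mulr_ge0 ?ltW//.
have le : enorm (w - c) ^+ 2 <= enorm (x - c) ^+ 2 + enorm (y - c) ^+ 2.
  rewrite !enorm_row_sqr -big_split/=; apply: ler_sum => i _.
  by rewrite !mxE; exact: sqr_between_le.
rewrite (le_lt_trans le)// exprMn.
have := sq _ xr; have := sq _ yr; nra.
Qed.

Lemma norm_line_diff_le g (x : 'rV[R]_n) i (K h : R) :
  (forall t, Num.min 0 h <= t <= Num.max 0 h ->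
     derivable g (x + t *: e_ i) (e_ i) /\ `|partial i g (x + t *: e_ i)| <= K) ->
  `|g (x + h *: e_ i) - g x| <= K * `|h|.
Proof.
have [h0 H|h0 H] := leP 0 h.
  by rewrite (ger0_norm h0); apply: norm_line_diff_le_ge0 => // t /H[].
have E t : x + h *: e_ i + t *: e_ i = x + (h + t) *: e_ i by rewrite scalerDl addrA.
have I t : 0 <= t <= - h -> h <= h + t <= 0 by lra.
have := @norm_line_diff_le_ge0 R n g (x + h *: e_ i) i K (- h).
rewrite E subrr scale0r addr0 distrC (ltr0_norm h0); apply; first by lra.
  by move=> t /I /H; rewrite E => -[].
by move=> t /I /H; rewrite E => -[].
Qed.

(** The vertices [z k] take their first [k] coordinates from [x] and the others
    from [y], so that the increments along the edges telescope. *)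
Lemma norm_path_diff_le g (x y : 'rV[R]_n) (K : R) :
  (forall w i, between x y w -> derivable g w (e_ i) /\ `|partial i g w| <= K) ->
  `|g x - g y| <= K * \sum_i `|x 0 i - y 0 i|.
Proof.
move=> H; pose z k : 'rV[R]_n := \row_i if (i < k)%N then x 0 i else y 0 i.
have -> : x = z n by apply/rowP => i; rewrite mxE ltn_ord.
have -> : y = z 0%N by apply/rowP => i; rewrite mxE.
rewrite -(telescope_sumr (fun k => g (z k)))// big_mkord.
rewrite (le_trans (ler_norm_sum _ _ _))// mulr_sumr; apply: ler_sum => k _.
rewrite !mxE ltn_ord /=.
have -> : z k.+1 = z k + (x 0 k - y 0 k) *: e_ k.
  apply/rowP => i; rewrite !mxE eqxx/= ltnS leq_eqVlt.
  have [->|ik] := eqVneq i k; first by rewrite eqxx ltnn /= mulr1 addrC subrK.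
  by rewrite (inj_eq val_inj) (negbTE ik) mulr0 addr0.
apply: norm_line_diff_le => t th; apply: H => i; rewrite !mxE eqxx/=.
have [->|ik] := eqVneq i k.
  rewrite ltnn mulr1; move: th; case: (leP (x 0 k) (y 0 k)) => xy;
  by case: (leP 0 (x 0 k - y 0 k)) => _ /andP[]; lra.
by rewrite mulr0 addr0; case: ifP => _; rewrite ge_min le_max lexx ?orbT.
Qed.
End coordinate_paths.

(** * Lower bounds for Lebesgue norms *)

Section integral_bounds.
Local Open Scope ereal_scope.
Variable R : realType.

(** The integral of a nonnegative function is a supremum over the simple
    functions below it, hence monotone without any measurability; this avoids
    showing that the norm of the Hessian, cut off outside a ball, is measurable. *)
Lemma ge0_integral_monotone d (T : measurableType d)
    (mu : {measure set T -> \bar R}) (f g : T -> \bar R) :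
  (forall x, 0 <= f x) -> (forall x, f x <= g x) ->
  \int[mu]_x f x <= \int[mu]_x g x.
Proof.
move=> f0 fg.
rewrite !ge0_integralTE//; last by move=> x; exact: le_trans (fg x).
apply: ge_ereal_sup => _ [h hf <-]; apply: ereal_sup_ubound.
by exists h => // x; exact: le_trans (hf x) (fg x).
Qed.

(** The square of the norm is the [n]-th root of the integral; comparing it with
    [c] through [c ^+ n] also covers an infinite integral. *)
Lemma Lnorm_sqr_ge d (T : measurableType d) (mu : {measure set T -> \bar R})
    (F : T -> R) n (c : R) : (0 < n)%N -> (0 <= c)%R ->
  (c ^+ n)%:E <= \int[mu]_x (`|F x| ^+ (2 * n))%:E ->
  c%:E <= 'N[mu]_((2 * n)%:R%:E)[EFin \o F] ^+ 2.
Proof.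
move=> n0 c0; rewrite unlock /=.
have -> : \int[mu]_x (`|F x| ^+ (2 * n))%:E =
    \int[mu]_x (`|(F x)%:E| `^ (2 * n)%:R).
  by apply: eq_integral => x _; rewrite /= powR_mulrn.
set I := integral _ _ _ => cI.
have n20 : (0 <= (2 * n)%:R^-1 :> R)%R by rewrite invr_ge0.
have sqrtE : (c ^+ n)%:E `^ (2 * n)%:R^-1 = (Num.sqrt c)%:E.
  rewrite poweR_EFin -powR_mulrn// -powRrM natrM invfM mulrCA mulfV ?pnatr_eq0 -?lt0n//.
  by rewrite mulr1 powR12_sqrt.
have le : (Num.sqrt c)%:E <= I `^ (2 * n)%:R^-1.
  rewrite -sqrtE; apply: gt0_ler_poweR => //.
    by rewrite in_itv/= lee_fin exprn_ge0// leey.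
  by rewrite in_itv/= leey (le_trans _ cI)// lee_fin exprn_ge0.
rewrite -(sqr_sqrtr c0) EFin_expe !expe2.
by apply: lee_pmul => //; rewrite lee_fin sqrtr_ge0.
Qed.

Lemma lebesgue_cube n (x : 'rV[R]_n) (d : R) : (0 < d)%R ->
  let Q := [set y : 'rV[R]_n | forall i, `[(x 0%R i - d)%R, (x 0%R i + d)%R]%classic (y 0%R i)] in
  measurable Q /\ @lebesgue_rV R n Q = ((2 * d) ^+ n)%:E.
Proof.
move=> d0 Q; have mA (i : 'I_n) :
    measurable (`[(x 0%R i - d)%R, (x 0%R i + d)%R]%classic : set (measurableTypeR R)).
  exact: measurable_itv.
split; first exact: (measurable_box mA).
rewrite (lebesgue_rV_box mA) (eq_bigr (fun=> (2 * d)%:E)).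
  by rewrite prodEFin prodr_const card_ord.
move=> i _; rewrite lebesgue_measure_itv/= lte_fin ifT; last by lra.
by rewrite -EFinD; congr _%:E; ring.
Qed.

Lemma Lnorm_cube_ge n (F : 'rV[R]_n -> R) (x : 'rV[R]_n) (d k : R) :
  (0 < n)%N -> (0 < d)%R -> (0 <= k)%R ->
  (forall y : 'rV[R]_n, (forall i, (`|y 0 i - x 0 i| <= d)%R) -> (k <= F y)%R) ->
  (k ^+ 2 * (2 * d))%:E <=
    'N[@lebesgue_rV R n]_((2 * n)%:R%:E)[EFin \o F] ^+ 2.
Proof.
move=> n0 d0 k0 kF; have [mQ muQ] := lebesgue_cube x d0.
set Q := (X in measurable X) in mQ muQ.
have d20 : (0 <= 2 * d)%R by rewrite mulr_ge0// ltW.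
apply: Lnorm_sqr_ge => //; first by rewrite mulr_ge0 ?sqr_ge0.
have -> : ((k ^+ 2 * (2 * d)) ^+ n)%:E =
    \int[@lebesgue_rV R n]_y ((k ^+ (2 * n))%:E * (\1_Q y)%:E).
  rewrite ge0_integralZl_EFin ?exprn_ge0//; last first.
    by apply/measurable_EFinP; exact: measurable_indic.
  by rewrite integral_indic// setIT exprMn -exprM EFinM -muQ.
apply: ge0_integral_monotone => y.
  by rewrite mule_ge0 ?lee_fin ?exprn_ge0.
rewrite indicE; have [/set_mem yQ|_] := boolP (y \in Q); last first.
  by rewrite mule0 lee_fin exprn_ge0.
rewrite mule1 lee_fin lerXn2r ?nnegrE//.
rewrite (le_trans _ (ler_norm _))//; apply: kF => i.
by rewrite ler_distl; have := yQ i; rewrite /= in_itv.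
Qed.

(** Cauchy-Schwarz for the derivative [g] of [V].  With [m] the mean slope,
    [g^2 >= 2 m g - m^2], and the right-hand side integrates to
    [(V b - V a)^2 / (b - a)] because it has the antiderivative [G]. *)
Lemma sqr_increment_le (V g : R -> R) (a b : R) : (a < b)%R ->
  (forall t : R, (a <= t <= b)%R -> is_derive t 1%R V (g t)) ->
  (forall t : R, (a <= t <= b)%R -> {for t, continuous g}) ->
  ((V b - V a) ^+ 2 / (b - a))%:E <=
    \int[lebesgue_measure]_(t in `[a, b]) (g t ^+ 2)%:E.
Proof.
move=> ab dV cg; pose m : R := ((V b - V a) / (b - a))%R.
pose G : R -> R := ((m *+ 2 \*: V) - (m ^+ 2 \*: id))%R.
pose dG (t : R) := (m *+ 2 * g t - m ^+ 2 * 1)%R.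
have ba0 : (b - a != 0)%R by rewrite subr_eq0 gt_eqF.
have cdG (t : R) : (a <= t <= b)%R -> {for t, continuous dG}.
  move=> /cg ct; apply: cvgB; last exact: cvg_cst.
  by apply: cvgM => //; exact: cvg_cst.
have dGP (t : R) : (a <= t <= b)%R -> is_derive t 1%R G (dG t).
  by move=> /dV dt; apply: is_deriveB.
have within_itv (h : R -> R) : (forall t : R, (a <= t <= b)%R -> {for t, continuous h}) ->
    {within `[a, b], continuous h}.
  by move=> ch; apply: continuous_in_subspaceT => t; rewrite inE/= in_itv/= => /ch.
have cV : {within `[a, b], continuous G}.
  by apply: derivable_within_continuous => t; rewrite in_itv/= => /dGP[].
have -> : (((V b - V a) ^+ 2 / (b - a)) = G b - G a)%R.
  have GE t : (G t = m *+ 2 * V t - m ^+ 2 * t)%R by [].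
  by rewrite !GE /m; field.
have [_ Ga Gb] := (continuous_within_itvP _ ab).1 cV.
rewrite EFinB -(@continuous_FTC2 _ dG G a b ab (within_itv _ cdG)); last 2 first.
- split=> [t||]; [|exact: Ga|exact: Gb].
  rewrite in_itv/= => /andP[at_ tb].
  have ti : (a <= t <= b)%R by rewrite !ltW.
  by case: (dGP t ti).
- move=> t; rewrite in_itv/= => /andP[at_ tb].
  have ti : (a <= t <= b)%R by rewrite !ltW.
  by rewrite derive1E; case: (dGP t ti).
apply: le_integral => //.
- by apply: continuous_compact_integrable; [exact: segment_compact|exact: within_itv].
- apply: continuous_compact_integrable; first exact: segment_compact.
  by apply: within_itv => t /cg ct; exact: (continuous_comp ct (@exprn_continuous _ 2 _)).
move=> t _; rewrite lee_fin -subr_ge0.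
have -> : (g t ^+ 2 - dG t = (g t - m) ^+ 2)%R by rewrite /dG; ring.
exact: sqr_ge0.
Qed.
End integral_bounds.

Section line_integral.
Local Open Scope ereal_scope.
Variable R : realType.
Local Notation e0 := (delta_mx 0%R 0%R : 'rV[R]_1).
Local Notation mu := (@lebesgue_measure R).

Lemma rV1E (x : 'rV[R]_1) : x = (x 0%R 0%R *: e0)%R.
Proof. by apply/rowP => i; rewrite !ord1 !mxE !eqxx mulr1. Qed.

Lemma rV_consE_line (t : R) : rV_cons (0%R : 'rV[R]_0, t) = (t *: e0)%R.
Proof. by rewrite [LHS]rV1E rV_consE0. Qed.

Lemma measurable_line : measurable_fun setT (fun t : measurableTypeR R => (t *: e0)%R).
Proof.
apply: measurable_fun_rV => i; under eq_fun do rewrite mxE.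
by apply: measurable_funM => //; exact: measurable_cst.
Qed.

(** The measure on row vectors of length one is a product with the unit mass on
    the one-point space of empty row vectors, so only the section over that point
    counts. *)
Lemma lebesgue_rV1E (A : set 'rV[R]_1) : measurable A ->
  lebesgue_rV A = pushforward mu (fun t : measurableTypeR R => (t *: e0)%R) A.
Proof.
move=> mA.
have mB : measurable (@rV_cons R 0 @^-1` A).
  by rewrite -[X in measurable X]setTI; exact: measurable_rV_cons.
rewrite /lebesgue_rV /pushforward /product_measure1.
rewrite integral_dirac//; last exact: measurable_fun_xsection.
rewrite diracT mul1e /=; congr (mu _).
by apply/seteqP; split => t; rewrite /xsection/= ?inE/= rV_consE_line.
Qed.

Lemma ge0_integral_rV1 (G : 'rV[R]_1 -> \bar R) :
  measurable_fun setT G -> (forall x, 0 <= G x) ->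
  \int[@lebesgue_rV R 1]_x G x = \int[mu]_t G (t *: e0)%R.
Proof.
move=> mG G0.
pose nu := measure_function_pushforward__canonical__measure_function_Measure
  mu measurable_line.
have /eq_measure_integral -> : forall A : set 'rV[R]_1, measurable A ->
    A `<=` setT -> @lebesgue_rV R 1 A = nu A.
  by move=> A mA _; exact: lebesgue_rV1E.
exact: (ge0_integral_pushforward measurable_line).
Qed.

Lemma sqr_increment_le_Lnorm (F : 'rV[R]_1 -> R) (V g : R -> R) (a b : R) :
  (a < b)%R ->
  (forall t : R, (a <= t <= b)%R -> is_derive t 1%R V (g t)) ->
  (forall t : R, (a <= t <= b)%R -> {for t, continuous g}) ->
  (forall t : R, (a <= t <= b)%R -> (`|g t| <= `|F (t *: e0)|)%R) ->
  ((V b - V a) ^+ 2 / (b - a))%:E <=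
    'N[@lebesgue_rV R 1]_((2 * 1)%:R%:E)[EFin \o F] ^+ 2.
Proof.
move=> ab dV cg gF; apply: Lnorm_sqr_ge => //.
  by rewrite divr_ge0 ?sqr_ge0// subr_ge0 ltW.
rewrite expr1; apply: (le_trans (sqr_increment_le ab dV cg)).
(* The integral over [a, b] becomes one of a measurable function on the row
   vectors of length one, to be compared with the given integrand there. *)
pose h := (fun t : measurableTypeR R => (g t ^+ 2)%:E) \_ `[a, b].
have h0 t : 0 <= h t by apply: erestrict_ge0 => s _; rewrite lee_fin sqr_ge0.
have mh : measurable_fun setT h.
  apply/(measurable_restrictT _ _).1 => //; apply/measurable_EFinP.
  apply: subspace_continuous_measurable_fun => //.
  apply: continuous_in_subspaceT => t; rewrite inE/= in_itv/= => /cg ct.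
  exact: (continuous_comp ct (@exprn_continuous _ 2 _)).
have -> : \int[mu]_(t in `[a, b]) (g t ^+ 2)%:E =
    \int[@lebesgue_rV R 1]_x h (x 0%R 0%R).
  rewrite integral_mkcond ge0_integral_rV1//.
    by apply: eq_integral => t _; rewrite !mxE !eqxx mulr1.
  exact: measurableT_comp mh (measurable_coord _).
apply: ge0_integral_monotone => // x; rewrite /h /patch.
case: ifPn => [|_]; last by rewrite lee_fin exprn_ge0.
rewrite inE/= in_itv/= => /gF; rewrite -rV1E => gx.
by rewrite lee_fin -real_normK ?num_real// lerXn2r ?nnegrE.
Qed.

End line_integral.

(** * Increments of the gradient *)

Section gradient_increments.
Variable R : realType.
Local Notation e_ i := (delta_mx 0 i).

(** Coordinatewise, [s^2 <= 2 t^2 + 2 (s - t)^2]. *)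
Lemma enorm_grad_sqr_le n (u : 'rV[R]_n -> R) x y :
  enorm (grad u x) ^+ 2 <=
  2 * enorm (grad u y) ^+ 2 + 2 * \sum_j (partial j u x - partial j u y) ^+ 2.
Proof.
rewrite !enorm_row_sqr !mulr_sumr -big_split/=; apply: ler_sum => j _.
rewrite !mxE; move: (partial j u x) (partial j u y) => s t.
have := sqr_ge0 (s - 2 * t); nra.
Qed.

Lemma eball_coord_dist n (c x y : 'rV[R]_n) r i :
  eball c r x -> eball c r y -> `|x 0 i - y 0 i| <= 2 * r.
Proof.
rewrite /eball/= => xr yr.
have := norm_entry_le_enorm (x - c) 0 i; have := norm_entry_le_enorm (y - c) 0 i.
rewrite !mxE => yc xc; apply: (le_trans (ler_distD (c 0 i) _ _)).
by rewrite [X in _ + X]distrC; lra.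
Qed.

Lemma cube_sub_eball n (c y : 'rV[R]_n) r : (0 < n)%N -> 0 < r ->
  (forall i, `|y 0 i - c 0 i| <= r / n%:R) -> eball c (2 * r) y.
Proof.
move=> n0 r0 yc; have n1 : 1 <= n%:R :> R by rewrite ler1n.
rewrite /eball/= -ltr_sqr ?nnegrE ?enorm_ge0 ?mulr_ge0 ?ltW//.
rewrite enorm_row_sqr (@le_lt_trans _ _ (\sum_(i < n) (r / n%:R) ^+ 2))//.
  apply: ler_sum => i _; rewrite !mxE -real_normK ?num_real//.
  by rewrite lerXn2r ?nnegrE ?divr_ge0// ltW.
rewrite sumr_const card_ord -[ltLHS]mulr_natl.
have -> : n%:R * (r / n%:R) ^+ 2 = r ^+ 2 / n%:R.
  by field; rewrite gt_eqF// (lt_le_trans _ n1).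
rewrite (@le_lt_trans _ _ (r ^+ 2))//; last by nra.
by rewrite ler_pdivrMr ?(lt_le_trans _ n1)// ler_peMr ?sqr_ge0.
Qed.

Section smooth.
Variables (n : nat) (O : set 'rV[R]_n) (u : 'rV[R]_n -> R).
Hypotheses (oO : open O) (su : smooth_on O u).

Lemma hess_sym x : O x -> (hess u x)^T = hess u x.
Proof.
move=> Ox; apply/matrixP => i j; rewrite !mxE.
apply: (@partialC R n O u x j i oO Ox).
- by move=> y k Oy; exact: (su [::] Oy).2.
- by move=> y k l Oy; exact: (su [:: k] Oy).2.
- by move=> k l; exact: (su [:: k; l] Ox).1.
Qed.

Lemma sum_sqr_partial_diff_le (K r : R) (c x y : 'rV[R]_n) : 0 < r ->
  eball c (2 * r) `<=` O ->
  (forall z i j, O z -> `|hess u z i j| <= K) ->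
  eball c r x -> eball c r y ->
  \sum_j (partial j u x - partial j u y) ^+ 2
    <= 4 * n%:R ^+ 3 * K ^+ 2 * r ^+ 2.
Proof.
move=> r0 cO HK xr yr.
have diff j : `|partial j u x - partial j u y| <= n%:R * K * (2 * r).
  apply: (@le_trans _ _ (K * \sum_i `|x 0 i - y 0 i|)).
    apply: norm_path_diff_le => w i bw.
    have Ow : O w by apply: cO; exact: between_eball bw.
    split; first exact: (su [:: j] Ow).2.
    by have := HK w i j Ow; rewrite mxE.
  have K0 : 0 <= K.
    have Ox : O x.
      by apply: cO; rewrite /eball/= (lt_trans xr)// ltr_pMl// ltr1n.
    exact: le_trans (normr_ge0 _) (HK x j j Ox).
  apply: (@le_trans _ _ (K * \sum_(i < n) (2 * r))).
    by rewrite ler_wpM2l// ler_sum// => i _; exact: eball_coord_dist xr yr.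
  by rewrite sumr_const card_ord -[X in K * X]mulr_natl mulrA [K * _]mulrC.
apply: (@le_trans _ _ (\sum_(j < n) (n%:R * K * (2 * r)) ^+ 2)).
  apply: ler_sum => j _; rewrite -real_normK ?num_real//.
  by rewrite lerXn2r ?nnegrE// (le_trans _ (diff j)).
by rewrite sumr_const card_ord -[leLHS]mulr_natl le_eqVlt; apply/orP; left; apply/eqP; ring.
Qed.
End smooth.
End gradient_increments.

Section one_dimensional.
Variables (R : realType) (O : set 'rV[R]_1) (u : 'rV[R]_1 -> R).
Hypothesis su : smooth_on O u.
Local Notation e0 := (delta_mx 0 0 : 'rV[R]_1).

(** [sqr_increment_le] for the derivative of [u], whose own derivative is the only
    entry of the Hessian. *)
Lemma sqr_partial_diff_le_Lnorm (c x y : 'rV[R]_1) (r : R) : 0 < r ->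
  eball c (2 * r) `<=` O -> eball c r x -> eball c r y ->
  (((partial 0 u x - partial 0 u y) ^+ 2)%:E <= (2 * r)%:E *
    'N[@lebesgue_rV R 1]_((2 * 1)%:R%:E)
      [EFin \o ((fun x => enorm (hess u x)) \_ (eball c (2 * r)))] ^+ 2)%E.
Proof.
move=> r0 cO.
wlog xy : x y / x 0 0 < y 0 0 => [H xr yr|xr yr].
  have [xy|xy|xy] := ltgtP (x 0 0) (y 0 0); first exact: H xy xr yr.
    by rewrite -sqrrN opprB; exact: H xy yr xr.
  have -> : x = y by rewrite (rV1E x) xy -rV1E.
  by rewrite subrr expr0n mule_ge0 ?expe_ge0 ?Lnorm_ge0// lee_fin mulr_ge0// ltW.
set F := _ \_ _.
have inball t : x 0 0 <= t <= y 0 0 -> eball c (2 * r) (t *: e0).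
  move=> txy; apply: (between_eball r0 xr yr) => i.
  by rewrite !ord1 !mxE !eqxx mulr1 (min_l (ltW xy)) (max_r (ltW xy)).
have inO t : x 0 0 <= t <= y 0 0 -> O (t *: e0) by move=> /inball/cO.
pose V t := partial 0 u (t *: e0).
pose g t := partial 0 (partial 0 u) (t *: e0).
have line (h : 'rV[R]_1 -> R) t : derivable h (t *: e0) e0 ->
    is_derive t (1 : R) (fun s : R => h (s *: e0)) (partial 0 h (t *: e0)).
  have := @is_derive_line R 1 h 0 0 t; rewrite add0r.
  have -> // : (fun s : R => h (0 + s *: e0)) = (fun s : R => h (s *: e0)).
  by apply/funext => s; rewrite add0r.
have dV t : x 0 0 <= t <= y 0 0 -> is_derive t (1 : R) V (g t).
  by move=> /inO Ot; apply: line; exact: (su [:: 0] Ot).2.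
have cg t : x 0 0 <= t <= y 0 0 -> {for t, continuous g}.
  move=> /inO Ot; apply/differentiable_continuous/derivable1_diffP.
  by case: (line _ t ((su [:: 0; 0] Ot).2 0)).
have gF t : x 0 0 <= t <= y 0 0 -> `|g t| <= `|F (t *: e0)|.
  move=> /inball bt; rewrite /F patchE mem_set// (ger0_norm (enorm_ge0 _)).
  by have := norm_entry_le_enorm (hess u (t *: e0)) 0 0; rewrite mxE.
have := sqr_increment_le_Lnorm xy dV cg gF; rewrite /V -!rV1E -sqrrN opprB.
set N2 := (_ ^+ 2)%E => le.
have yx0 : 0 < y 0 0 - x 0 0 by rewrite subr_gt0.
apply: (@le_trans _ _ ((y 0 0 - x 0 0)%:E * N2)%E).
  by rewrite -lee_pdivrMl// -EFinM mulrC.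
rewrite lee_wpmul2r ?expe_ge0 ?Lnorm_ge0// lee_fin.
by rewrite (le_trans (ler_norm _))// (eball_coord_dist _ yr xr).
Qed.
End one_dimensional.

(** * The gradient estimate *)

Section extrema.
Local Open Scope ereal_scope.
Variable R : realType.

(** For finite [E] the hypothesis says that [P x / c - E] is a lower bound of
    [P]; for infinite [E] the right-hand side is infinite. *)
Lemma ereal_sup_le_ereal_inf (T : Type) (A : set T) (P : T -> R) (c : R) (E : \bar R) :
  (0 < c)%R -> 0 <= E -> (forall x, (0 <= P x)%R) ->
  (forall x y, A x -> A y -> (P x)%:E <= c%:E * ((P y)%:E + E)) ->
  ereal_sup [set (P x)%:E | x in A] <=
    c%:E * (ereal_inf [set (P x)%:E | x in A] + E).
Proof.
move=> c0 E0 P0 H; apply: ge_ereal_sup => _ [x Ax <-].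
have inf0 : 0 <= ereal_inf [set (P x)%:E | x in A].
  by apply: le_ereal_inf_tmp => _ [y _ <-]; rewrite lee_fin.
case: E E0 H => [e| |] // E0 H; last first.
  by rewrite addey ?gt0_muley ?leey ?lte_fin// gt_eqF// (lt_le_trans _ inf0)// ltNy0.
rewrite -lee_pdivrMl// -EFinM -leeBlDr// -EFinB.
apply: le_ereal_inf_tmp => _ [y Ay <-].
have := H x y Ax Ay; rewrite -EFinD -EFinM !lee_fin => Hxy.
by rewrite lerBlDr ler_pdivrMl.
Qed.
End extrema.

Lemma le_lincomb_ereal (R : realType) (C P Q q : R) (E : \bar R) :
  2 <= C -> 0 <= Q -> (0 <= E)%E -> P <= 2 * Q + q -> (q%:E <= C%:E * E)%E ->
  (P%:E <= C%:E * (Q%:E + E))%E.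
Proof.
move=> C2 Q0 E0 PQ qE; rewrite ge0_muleDr ?lee_fin//.
apply: (@le_trans _ _ ((2 * Q)%:E + q%:E)%E); first by rewrite -EFinD lee_fin.
by rewrite leeD// -EFinM lee_fin ler_wpM2r.
Qed.

Unset Implicit Arguments.
Set Strict Implicit.

Theorem corollary5p3 (R : realType) :
  exists C : nat -> R -> R -> R -> R,
  forall (n : nat) (Omega : set 'rV[R]_n)
    (u : 'rV[R]_n -> R) (f : R -> 'rV[R]_n -> R) (lam Lam M : R),
  (0 < n)%N ->
  domain Omega ->
  smooth_on Omega u ->
  convex_on Omega u ->
  (forall s q, 0 < f s q) ->
  (forall s q, derivable (f ^~ q) s 1) ->
  (forall s q i, derivable (f s) q (delta_mx 0 i)) ->
  (forall x, Omega x -> \det (hess u x) = f (u x) (grad u x)) ->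
  0 < lam -> lam <= Lam ->
  (forall x (xi : 'rV[R]_n), Omega x ->
     lam * enorm xi ^+ 2 <=
       \sum_i \sum_j adjT (hess u x) i j * xi 0 i * xi 0 j
       <= Lam * enorm xi ^+ 2) ->
  ((fun x => enorm (hess u x) ^+ 2) \_ Omega)
    \in Lfun (@lebesgue_rV R n) n%:R%:E ->
  (forall x, Omega x -> `|derive1 (f ^~ (grad u x)) (u x)| <= M) ->
  (forall x i, Omega x -> `|partial i (f (u x)) (grad u x)| <= M) ->
  (forall x i j, Omega x -> `|adjT (hess u x) i j| <= M) ->
  forall (x0 : 'rV[R]_n) (r : R), 0 < r -> eball x0 (2 * r) `<=` Omega ->
  (ereal_sup [set (enorm (grad u x) ^+ 2)%:E | x in eball x0 r] <=
   (C n lam Lam (M * r ^+ 2))%:E *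
   (ereal_inf [set (enorm (grad u x) ^+ 2)%:E | x in eball x0 r] +
    (r / lam)%:E *
    'N[@lebesgue_rV R n]_((2 * n)%:R%:E)
      [EFin \o ((fun x => enorm (hess u x)) \_ (eball x0 (2 * r)))] ^+ 2))%E.
Proof.
(* [K] bounds the entries of the Hessian and [k] bounds its Frobenius norm from
   below.  In the constant, [2] multiplies the infimum, [4 * lam] serves the
   one-dimensional case, and the last term is the ratio of [8 n^3 K^2 r^2] to
   [(r / lam) (2 k^2 r / n)]. *)
pose K (n : nat) (lam Lam : R) : R := (1 + n`!%:R * Lam ^+ n) / lam.
pose k (n : nat) (lam : R) : R := Num.min 1 (lam / n.-1`!%:R).
exists (fun n lam Lam _ =>
  2 + 4 * lam + 4 * n%:R ^+ 4 * K n lam Lam ^+ 2 * lam / k n lam ^+ 2).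
move=> n O u f lam Lam M n0 [oO _ _] su _ f0 _ _ detE lam0 _ quadB _ _ _ _ c r r0 cO.
set N2 := (X in ((r / lam)%:E * X)%E); set C := (X in (X%:E * _)%E).
have N20 : (0 <= N2)%E by rewrite expe_ge0 ?Lnorm_ge0.
have E0 : (0 <= (r / lam)%:E * N2)%E by rewrite mule_ge0// lee_fin divr_ge0// ltW.
pose D := 4 * n%:R ^+ 4 * K n lam Lam ^+ 2 * lam / k n lam ^+ 2.
have CE : C = 2 + 4 * lam + D by [].
have D0 : 0 <= D.
  apply: divr_ge0; last exact: sqr_ge0.
  by rewrite mulr_ge0 ?(ltW lam0)// mulr_ge0 ?sqr_ge0// mulr_ge0 ?exprn_ge0.
have C2 : 2 <= C by rewrite CE; lra.
apply: ereal_sup_le_ereal_inf => //; [by lra|by move=> x; exact: sqr_ge0|].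
move=> x y xr yr; apply: (le_lincomb_ereal C2 (sqr_ge0 _) E0).
  exact: (enorm_grad_sqr_le u x y).
destruct n as [|[|n]] => //.
  rewrite big_ord1 EFinM.
  have H := sqr_partial_diff_le_Lnorm su r0 cO xr yr.
  apply: (@le_trans _ _ ((4 * lam)%:E * ((r / lam)%:E * N2))%E).
    rewrite [leRHS]muleA -[in leRHS]EFinM (_ : 4 * lam * (r / lam) = 2 * (2 * r)); last first.
      by field; rewrite gt_eqF.
    by rewrite [in leRHS]EFinM -[leRHS]muleA lee_pmul2l.
  by rewrite lee_wpmul2r// lee_fin CE; lra.
have k0 : 0 < k n.+2 lam.
  by rewrite /k lt_min ltr01 divr_gt0// ltr0n fact_gt0.
have HK z i j : O z -> `|hess u z i j| <= K n.+2 lam Lam.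
  move=> Oz; apply: elliptic_norm_entry_le => //.
  - by move=> xi; exact: quadB.
  - exact: hess_sym Oz.
  - by rewrite detE.
have lower : ((k n.+2 lam ^+ 2 * (2 * (r / n.+2%:R)))%:E <= N2)%E.
  apply: (@Lnorm_cube_ge _ _ _ c) => //; [by rewrite divr_gt0|exact: ltW|].
  move=> z zc; have bz := cube_sub_eball n0 r0 zc.
  rewrite patchE mem_set//; apply: (elliptic_enorm_ge (Lam := Lam)) => xi.
  exact: quadB (cO _ bz).
have S := sum_sqr_partial_diff_le su r0 cO HK xr yr.
apply: (@le_trans _ _ (D%:E * ((r / lam)%:E * N2))%E); last first.
  by rewrite lee_wpmul2r// lee_fin CE; lra.
apply: (@le_trans _ _
    (D%:E * ((r / lam)%:E * (k n.+2 lam ^+ 2 * (2 * (r / n.+2%:R)))%:E))%E); last first.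
  by rewrite !lee_wpmul2l// lee_fin divr_ge0// ltW.
rewrite -!EFinM lee_fin.
have -> : D * (r / lam * (k n.+2 lam ^+ 2 * (2 * (r / n.+2%:R)))) =
    2 * (4 * n.+2%:R ^+ 3 * K n.+2 lam Lam ^+ 2 * r ^+ 2).
  by rewrite /D; field; rewrite !gt_eqF.
by rewrite ler_pM2l.
Qed.
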